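(* The class $\mathbf{CRL}$ of completely representable bounded distributive lattices is not closed under elementary equivalence; that is, there are elementarily equivalent bounded lattices $L$ and $L'$ (in the first-order language of bounded lattices) with $L'\in\mathbf{CRL}$ and $L\notin\mathbf{CRL}$.
   Context: A representation of a bounded distributive lattice $L$ is a lattice embedding $h\colon L\to\wp(X)$ for some set $X$, where $\wp(X)$ is regarded as a ring of sets under union and intersection; representations are assumed irredundant, i.e. for every $x\in X$ there is $a\in L$ with $x\in h(a)$. A representation $h$ is complete if for all $S\subseteq L$: whenever $\bigwedge S$ exists in $L$, $h(\bigwedge S)=\bigcap h[S]$, and whenever $\bigvee S$ exists in $L$, $h(\bigvee S)=\bigcup h[S]$. $\mathbf{CRL}$ is the class of bounded distributive lattices that have a complete representation. *)

(* Defs.v *)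
From mathcomp Require Import all_boot all_order.
From mathcomp Require Import boolp classical_sets.

Set Implicit Arguments.
Unset Strict Implicit.
Unset Printing Implicit Defensive.

Local Open Scope classical_set_scope.

(* The first-order language of bounded lattices, with equality.
   Variables are well-scoped de Bruijn indices: [term n] and [formula n] have
   their free variables among n, so that a sentence is a [formula 0]; under a
   quantifier, [ord0] is the newly bound variable. *)
Inductive term (n : nat) : Type :=
| TVar of 'I_n
| TBot
| TTop
| TMeet of term n & term n
| TJoin of term n & term n.

Inductive formula : nat -> Type :=
| FEq n of term n & term n : formula n
| FFalse n : formula n
| FAnd n of formula n & formula n : formula n
| FOr n of formula n & formula n : formula n
| FImp n of formula n & formula n : formula n
| FForall n of formula n.+1 : formula n
| FExists n of formula n.+1 : formula n.

Definition sentence : Type := formula 0.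

Section Semantics.
Context {d : Order.disp_t} {L : tbLatticeType d}.

Definition extend n (x : L) (e : 'I_n -> L) : 'I_n.+1 -> L :=
  fun i => if unlift ord0 i is Some j then e j else x.

Fixpoint eval n (e : 'I_n -> L) (t : term n) : L :=
  match t with
  | TVar i => e i
  | TBot => Order.bottom
  | TTop => Order.top
  | TMeet t1 t2 => Order.meet (eval e t1) (eval e t2)
  | TJoin t1 t2 => Order.join (eval e t1) (eval e t2)
  end.

Fixpoint holds n (phi : formula n) : ('I_n -> L) -> Prop :=
  match phi in formula n return ('I_n -> L) -> Prop with
  | FEq _ t1 t2 => fun e => eval e t1 = eval e t2
  | FFalse _ => fun=> False
  | FAnd _ p q => fun e => holds p e /\ holds q e
  | FOr _ p q => fun e => holds p e \/ holds q e
  | FImp _ p q => fun e => holds p e -> holds q e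
  | FForall _ p => fun e => forall x : L, holds p (extend x e)
  | FExists _ p => fun e => exists x : L, holds p (extend x e)
  end.

End Semantics.

(* The valuation of the empty set of variables is unique up to extensionality:
   the value [Order.bottom] is never used. *)
Definition models d (L : tbLatticeType d) (phi : sentence) : Prop :=
  holds phi (fun _ : 'I_0 => Order.bottom : L).

Definition elementarily_equivalent d (L : tbLatticeType d)
    d' (L' : tbLatticeType d') : Prop :=
  forall phi : sentence, models L phi <-> models L' phi.

Definition lattice_embedding d (L : tbLatticeType d) (X : Type)
    (h : L -> set X) : Prop :=
  [/\ injective h,
      forall a b : L, h (Order.meet a b) = h a `&` h b
    & forall a b : L, h (Order.join a b) = h a `|` h b].

Definition irredundant d (L : tbLatticeType d) (X : Type)
    (h : L -> set X) : Prop :=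
  forall x : X, exists a : L, h a x.

Definition representation d (L : tbLatticeType d) (X : Type)
    (h : L -> set X) : Prop :=
  lattice_embedding h /\ irredundant h.

(* [infimums S] and [supremums S] have at most one element, so [infimums S m]
   says that the meet of S exists and equals m. For empty S, the intersection
   is [setT] and the union is [set0]. *)
Definition complete_map d (L : tbLatticeType d) (X : Type)
    (h : L -> set X) : Prop :=
  forall S : set L,
    (forall m : L, infimums S m -> h m = \bigcap_(s in S) h s) /\
    (forall j : L, supremums S j -> h j = \bigcup_(s in S) h s).

Definition CRL d (L : tbLatticeType d) : Prop :=
  left_distributive (@Order.meet d L) (@Order.join d L) /\
  exists (X : Type) (h : L -> set X), representation h /\ complete_map h.

(* Main.v *)
(* The witnesses are the unit intervals of the reals and of the rationals,
   viewed as chains.  Any two dense chains with endpoints are elementarily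
   equivalent, by back-and-forth.  A point of a complete representation of a
   chain is a cut whose upper part has no infimum outside it and whose lower
   part has no supremum outside it.  A complete chain that is dense has no such
   cut, since the infimum m of the upper part lies in the upper part but is also
   the supremum of the elements below it.  In the rational unit interval, every
   irrational number is such a cut, and irrational cuts separate points. *)
Require Import Defs.
From HB Require Import structures.
From mathcomp Require Import all_boot all_order.
From mathcomp Require Import boolp classical_sets.
From mathcomp Require Import all_algebra reals Rstruct.

Set Implicit Arguments.
Unset Strict Implicit.
Unset Printing Implicit Defensive.

Import Order.TTheory GRing.Theory Num.Theory.

Local Open Scope classical_set_scope.

(** * Back-and-forth between dense chains with endpoints *)

Definition dense_chain d (L : tbOrderType d) :=
  (\bot < \top :> L)%O /\
  (forall x y : L, (x < y)%O -> exists z, (x < z)%O /\ (z < y)%O).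

(** A finite partial isomorphism, kept as a list of pairs: equality being two inequalities,
    agreement on [<=] makes the pairing single-valued and injective. *)
Definition order_matching d (L : tbOrderType d) d' (L' : tbOrderType d')
    (s : seq (L * L')) :=
  {in s &, forall p q, (p.1 <= q.1)%O = (p.2 <= q.2)%O}.

Section BackAndForth.
Local Open Scope order_scope.

Section Matching.
Context d (L : tbOrderType d) d' (L' : tbOrderType d').
Implicit Types s : seq (L * L').

Lemma order_matching_swap s :
  order_matching s -> order_matching [seq (p.2, p.1) | p <- s].
Proof. by move=> sP _ _ /mapP[p ps ->] /mapP[q qs ->] /=; rewrite sP. Qed.

Lemma mem_swap s x y : ((y, x) \in [seq (p.2, p.1) | p <- s]) = ((x, y) \in s).
Proof. by apply/mapP/idP => [[[a b] ab [-> ->]]//|xys]; exists (x, y). Qed.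

Lemma order_matching_extend s (x : L) :
  dense_chain L' -> order_matching s ->
  (\bot, \bot) \in s -> (\top, \top) \in s ->
  exists y : L', order_matching ((x, y) :: s).
Proof.
move=> [_ dL'] sP s0 s1.
have [[p ps px]|xN] := pselect (exists2 p, p \in s & p.1 = x).
  exists p.2; rewrite -px -surjective_pairing => q r.
  have sub : {subset p :: s <= s} by move=> z; rewrite inE => /predU1P[->|].
  by move=> /sub qs /sub rs; apply: sP.
have neq p : p \in s -> p.1 != x.
  by move=> ps; apply/eqP => px; apply: xN; exists p.
(* A partner of [x] must lie between [l] and [u]. The base values [\bot] and [\top] of the join and
   meet are harmless: they are themselves partners of points below and above [x]. *)
pose l := \join_(p <- s | p.1 < x) p.2.
pose u := \meet_(p <- s | x < p.1) p.2.
have x0 : \bot < x by rewrite lt_def le0x andbT eq_sym (neq _ s0).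
have x1 : x < \top by rewrite lt_def lex1 andbT (neq _ s1).
have lt_s p q : p \in s -> q \in s -> p.1 < x -> x < q.1 -> p.2 < q.2.
  by move=> ps qs px xq; rewrite ltNge -sP// -ltNge (lt_trans px).
have ltl q : q \in s -> x < q.1 -> l < q.2.
  move=> qs xq; rewrite /l big_seq_cond.
  elim/big_ind: _ => [|a b aq bq|p /andP[ps px]].
  - exact: (lt_s _ _ s0 qs).
  - by rewrite ltUx aq.
  - exact: lt_s.
have lu : l < u.
  rewrite /u big_seq_cond; elim/big_ind: _ => [|a b la lb|p /andP[ps xp]].
  - exact: (ltl _ s1).
  - by rewrite ltxI la.
  - exact: ltl.
have [y [ly yu]] := dL' _ _ lu.
have below p : p \in s -> p.1 < x -> p.2 < y.
  by move=> ps px; apply: le_lt_trans ly; apply: joins_sup_seq.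
have above p : p \in s -> x < p.1 -> y < p.2.
  by move=> ps xp; apply: lt_le_trans yu _; apply: meets_inf_seq.
exists y => p q; rewrite !inE => /predU1P[->|ps] /predU1P[->|qs] /=.
- by rewrite !lexx.
- have /lt_total/orP[xq|xq] := neq _ qs.
    by rewrite [x <= _]leNgt xq [RHS]leNgt (below _ qs xq).
  by rewrite !ltW// above.
- have /lt_total/orP[xp|xp] := neq _ ps.
    by rewrite !ltW// below.
  by rewrite [_ <= x]leNgt xp [RHS]leNgt (above _ ps xp).
- exact: sP.
Qed.

(** In a chain a meet or join is one of its two arguments, and the matching makes both chains choose
    the same one. *)
Lemma eval_matching s n (e : 'I_n -> L) (e' : 'I_n -> L') (t : term n) :
  order_matching s -> (\bot, \bot) \in s -> (\top, \top) \in s ->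
  (forall i, (e i, e' i) \in s) -> (eval e t, eval e' t) \in s.
Proof.
move=> sP s0 s1 es; elim: t => //= a IHa b IHb; have /= leab := sP _ _ IHa IHb;
  have /= leba := sP _ _ IHb IHa.
- have [ab|/ltW ab] := leP (eval e a) (eval e b).
    by rewrite (meet_l (x := eval e' a)) // -leab.
  by rewrite (meet_r (x := eval e' a)) // -leba.
- have [ab|/ltW ab] := leP (eval e a) (eval e b).
    by rewrite (join_r (x := eval e' a)) // -leab.
  by rewrite (join_l (x := eval e' a)) // -leba.
Qed.

Lemma extend_matching s n (e : 'I_n -> L) (e' : 'I_n -> L') x y :
  (forall i, (e i, e' i) \in s) ->
  forall i, (extend x e i, extend y e' i) \in (x, y) :: s.
Proof.
by move=> es i; rewrite /extend; case: unliftP => [j _|_];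
  rewrite inE ?es ?orbT ?eqxx.
Qed.

End Matching.

(** Induction on [phi] with [s] generalised: an equation is two inequalities between matched values,
    and a quantifier adds one matched pair to [s]. *)
Lemma holds_matching d (L : tbOrderType d) d' (L' : tbOrderType d')
    n (phi : formula n) (e : 'I_n -> L) (e' : 'I_n -> L') (s : seq (L * L')) :
  dense_chain L -> dense_chain L' -> order_matching s ->
  (\bot, \bot) \in s -> (\top, \top) \in s -> (forall i, (e i, e' i) \in s) ->
  holds phi e <-> holds phi e'.
Proof.
move=> dL dL'; elim: phi e e' s => {n}
  [n t u|n|n p IHp q IHq|n p IHp q IHq|n p IHp q IHq|n p IHp|n p IHp]
  e e' s sP s0 s1 es /=; try by have := IHp _ _ _ sP s0 s1 es;
    have := IHq _ _ _ sP s0 s1 es; tauto.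
- have tP := eval_matching t sP s0 s1 es.
  have uP := eval_matching u sP s0 s1 es.
  by split=> /eqP tu; apply/eqP; move: tu;
  rewrite !eq_le (sP _ _ tP uP) (sP _ _ uP tP).
- by [].
all: have sub x y z : z \in s -> z \in (x, y) :: s by rewrite inE orbC => ->.
all: have forth x : exists y, holds p (extend x e) <-> holds p (extend y e') by
  have [y yP] := order_matching_extend x dL' sP s0 s1;
  exists y; apply: (IHp _ _ _ yP _ _ (extend_matching x y es)); apply: sub.
(* The back step is the forth step for the transposed matching. *)
all: have back y : exists x, holds p (extend x e) <-> holds p (extend y e').
1,3: have := order_matching_extend y dL (order_matching_swap sP);
  rewrite !mem_swap => /(_ s0 s1)[x xP]; exists x;
  apply: (IHp _ _ ((x, y) :: s) _ _ _ (extend_matching x y es)); rewrite ?sub//;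
  by move=> [a b] [a' b'] ab ab'; symmetry; apply: (xP (b, a) (b', a'));
     rewrite inE xpair_eqE andbC -xpair_eqE mem_swap -in_cons.
- split=> [H y|H x]; first by have [x <-] := back y.
  by have [y ->] := forth x.
- split=> [[x]|[y]]; first by have [y ->] := forth x; exists y.
  by have [x <-] := back y; exists x.
Qed.

Lemma dense_chain_equivalent d (L : tbOrderType d) d' (L' : tbOrderType d') :
  dense_chain L -> dense_chain L' -> elementarily_equivalent L L'.
Proof.
move=> dL dL' phi.
have leF d0 (K : tbOrderType d0) : dense_chain K -> (\top <= \bot :> K) = false.
  by move=> [K01 _]; rewrite leNgt K01.
(* Pairing the endpoints is a matching because [\top <= \bot] fails in both chains. *)
pose s : seq (L * L') := [:: (\bot, \bot); (\top, \top)].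
apply: (@holds_matching _ _ _ _ _ _ _ _ s) => //; rewrite ?inE ?eqxx ?orbT//.
by move=> p q; rewrite !inE => /orP[]/eqP-> /orP[]/eqP->;
  rewrite /= ?lexx ?le0x ?leF.
Qed.

End BackAndForth.

(** * Complete dense chains *)

Lemma complete_dense_chain_notin_CRL d (L : tbOrderType d) :
  dense_chain L -> (forall S : set L, exists m, infimums S m) -> ~ CRL L.
Proof.
move=> [L01 dL] infL [_ [X [h [[[hinj _ _] irr] hcomp]]]].
(* Over an empty set of points, [h] would identify [\bot] and [\top]. *)
suff X0 : X -> False.
  have /hinj L01E : h \bot%O = h \top%O.
    by apply/seteqP; split=> x; case: (X0 x).
  by rewrite -L01E ltxx in L01.
move=> x; have [m mP] := infL [set a | h a x].
have hm : h m x by rewrite ((hcomp _).1 _ mP).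
(* By density, an upper bound [b < m] would leave some [c] strictly between. *)
have supm : supremums [set a | (a < m)%O] m.
  split=> [a /ltW//|b bub]; rewrite leNgt; apply/negP => bm.
  by have [c [/lt_geF + /bub]] := dL _ _ bm => ->.
move: hm; rewrite ((hcomp _).2 _ supm) => -[a am /mP.1].
by rewrite leNgt am.
Qed.

(** * Unit intervals of ordered fields *)

Local Open Scope ring_scope.

Definition unit_interval (F : realFieldType) := {x : F | 0 <= x <= 1}.

Section UnitInterval.
Variable F : realFieldType.
Local Notation I := (unit_interval F).

HB.instance Definition _ := SubType.on I.
HB.instance Definition _ := Choice.on I.
HB.instance Definition _ := [SubChoice_isSubOrder of I by <: with ring_display].

Let bot_subproof : 0 <= (0 : F) <= 1. Proof. by rewrite lexx ler01. Qed.
Let top_subproof : 0 <= (1 : F) <= 1. Proof. by rewrite lexx ler01. Qed.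

Let bot_le (x : I) : ((Sub 0 bot_subproof : I) <= x)%O.
Proof. by rewrite leEsub SubK; case/andP: (valP x). Qed.
Let le_top (x : I) : (x <= (Sub 1 top_subproof : I))%O.
Proof. by rewrite leEsub SubK; case/andP: (valP x). Qed.

HB.instance Definition _ := Order.hasBottom.Build ring_display I bot_le.
HB.instance Definition _ := Order.hasTop.Build ring_display I le_top.

Lemma unit_interval_between (a b : I) (x : F) :
  val a < x -> x < val b -> exists z : I, val z = x.
Proof.
move=> ax xb; have x01 : 0 <= x <= 1.
  have /andP[a0 _] := valP a; have /andP[_ b1] := valP b.
  by rewrite (le_trans a0 (ltW ax)) (le_trans (ltW xb) b1).
by exists (Sub x x01); rewrite SubK.
Qed.

Lemma unit_interval_dense : dense_chain (unit_interval F).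
Proof.
split=> [|x y xy]; first by rewrite -lt_val !SubK ltr01.
rewrite -lt_val in xy.
have [xm my] := midf_lt xy.
have [z zE] := unit_interval_between xm my.
by exists z; rewrite -!lt_val zE.
Qed.

End UnitInterval.

Lemma real_unit_interval_infimum (R : realType) (S : set (unit_interval R)) :
  exists m, infimums S m.
Proof.
(* The empty set is treated apart: its infimum in the interval is [\top], while the bounds on the
   real [inf] need a nonempty set. *)
have [->|/set0P[a Sa]] := eqVneq S set0.
  by exists \top%O; split=> // x _; exact: lex1.
have Sne : [set val x | x in S] !=set0 by exists (val a), a.
have lb0 : lbound [set val x | x in S] 0.
  by move=> _ [x _ <-]; case/andP: (valP x).
have lb : has_lbound [set val x | x in S] by exists 0.
have m01 : 0 <= inf [set val x | x in S] <= 1.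
  rewrite lb_le_inf//=; have /andP[_] := valP a.
  by apply: le_trans; apply: ge_inf => //; exists a.
exists (Sub (inf [set val x | x in S]) m01).
split=> [x Sx|x xlb]; rewrite -Order.le_val SubK.
  by apply: ge_inf => //; exists x.
by apply: lb_le_inf => // _ [y Sy <-]; rewrite Order.le_val; exact: xlb.
Qed.

(** * Irrational cuts of the rational unit interval *)

Lemma sqrt2_irrational (R : realType) : irrational (Num.sqrt 2 : R).
Proof.
rewrite irrationalE => q _ /= [_ -> qE].
have q2 : q ^+ 2 = 2.
  apply: (fmorph_inj (@ratr R)).
  by rewrite rmorphXn /= qE sqr_sqrtr ?ler0n// rmorph_nat.
have d0 := denq_neq0 q.
have : (`|numq q| ^ 2 = 2 * `|denq q| ^ 2)%N.
  apply/eqP; rewrite -eqz_nat PoszM -!abszX !gez0_abs ?sqr_ge0//.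
  by rewrite -(eqr_int rat) rmorphXn intrM rmorphXn/= numqE exprMn q2.
(* The exponent of 2 is even on the left and odd on the right. *)
move/(congr1 (logn 2)); rewrite lognM ?expn_gt0 ?absz_gt0 ?d0// !lognX.
by move/(congr1 odd); rewrite oddD !oddM.
Qed.

Lemma irrational_between (R : realType) (a b : rat) : a < b ->
  exists r : R, [/\ irrational r, ratr a < r & r < ratr b].
Proof.
move=> ab; have ba : 0 < ratr (b - a) :> R by rewrite ltr0q subr_gt0.
have s0 : 0 < Num.sqrt 2 :> R by rewrite sqrtr_gt0 ltr0n.
have s1 : 1 < Num.sqrt 2 :> R.
  by rewrite -[X in X < _]sqrtr1 ltr_sqrt ?ltr0n// ltr1n.
(* If this were a rational [q], then the root of 2 would be [(b - a) / (q - a)]. *)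
exists (ratr a + ratr (b - a) / Num.sqrt 2); split.
- rewrite irrationalE => q _ /= [_ -> qE].
  have := @sqrt2_irrational R; rewrite irrationalE.
  move=> /(_ ((b - a) / (q - a)) I); apply; eexists; first by [].
  rewrite fmorph_div/= (rmorphB _ q)/= qE [ratr a + _]addrC addrK.
  by rewrite invf_div mulrC divfK// gt_eqF.
- by rewrite ltrDl divr_gt0.
- rewrite -[X in _ < X](subrKC (ratr a)) ltrD2l -rmorphB.
  by rewrite ltr_pdivrMr// ltr_pMr.
Qed.

(* The empty meet is [\top] and the empty join is [\bot], so the cuts must lie
   strictly between 0 and 1. *)
Lemma rational_unit_interval_CRL (R : realType) : CRL (unit_interval rat).
Proof.
split; first exact: meetUl.
exists {r : R | irrational r /\ 0 < r < 1}.
pose h (q : unit_interval rat) : set {r : R | irrational r /\ 0 < r < 1} :=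
  [set r | sval r < ratr (val q)].
have mono a b : (a <= b)%O -> h a `<=` h b.
  by rewrite -Order.le_val => ab r /lt_le_trans; apply; rewrite ler_rat.
have not_mono a b : (a < b)%O -> ~ h b `<=` h a.
  rewrite -lt_val => /(@irrational_between R)[r [rI ar rb]].
  have r01 : 0 < r < 1.
    have /andP[a0 _] := valP a; have /andP[_ b1] := valP b.
    rewrite (le_lt_trans _ ar) ?ler0q// (lt_le_trans rb)//.
    by rewrite -(rmorph1 (@ratr R)) ler_rat.
  move=> /(_ (exist _ r (conj rI r01)) rb) /=.
  by rewrite /h/= ltNge ltW.
exists h; split; [split; [split|]|].
- move=> a b hab; case: (ltgtP a b) => // ab.
    by case: (not_mono _ _ ab); rewrite hab.
  by case: (not_mono _ _ ab); rewrite hab.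
- move=> a b; have [ab|/ltW ab] := leP a b.
    by apply/esym/setIidl/mono.
  by apply/esym/setIidr/mono.
- move=> a b; have [ab|/ltW ab] := leP a b.
    by apply/esym/setUidr/mono.
  by apply/esym/setUidl/mono.
- move=> [r [rI r01]]; exists \top%O; case/andP: (r01) => _ r1.
  by rewrite /h/= rmorph1.
move=> S; split=> [m [mlb mglb]|j [jub jlub]]; apply/seteqP; split.
- by move=> r hr s Ss; apply: mono (mlb _ Ss) _ hr.
- move=> [r [rI r01]] hr /=; rewrite /h/= ltNge; apply/negP => mr.
  (* Irrationality of [r] makes the inequality strict, leaving room for a rational [q] between [m]
     and [r]: a lower bound of [S] above [m]. *)
  have {}mr : ratr (val m) < r.
    rewrite lt_neqAle mr andbT; apply/eqP => mE.
    move: (rI); rewrite irrationalE => /(_ (val m) Logic.I); apply.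
    by exists (val m).
  have [q] := rat_in_itvoo mr; rewrite in_itv/= => /andP[].
  rewrite ltr_rat => mq qr.
  (* Here [r < 1] keeps [q] inside the interval, even when [S] is empty. *)
  have q1 : q < val (\top%O : unit_interval rat).
    by rewrite SubK -(@ltr_rat R) rmorph1 (lt_trans qr)//; case/andP: (r01).
  have [z zE] := unit_interval_between mq q1.
  have /mglb : lbound S z.
    move=> s Ss; rewrite -Order.le_val zE -(@ler_rat R).
    by rewrite ltW// (lt_trans qr)//; exact: hr.
  by rewrite -Order.le_val zE leNgt mq.
(* Dually, if no element of [S] exceeds [r], a rational between [r] and [j] is an upper bound of [S]
   below [j]. *)
- move=> [r [rI r01]] rj; apply: contrapT => Sr.
  have [q] := rat_in_itvoo rj; rewrite in_itv/= => /andP[rq].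
  rewrite ltr_rat => qj.
  have q0 : val (\bot%O : unit_interval rat) < q.
    by rewrite SubK -(@ltr0q R) (lt_trans _ rq)//; case/andP: (r01).
  have [z zE] := unit_interval_between q0 qj.
  have /jlub : ubound S z.
    move=> s Ss; rewrite -Order.le_val zE -(@ler_rat R).
    rewrite ltW// (le_lt_trans _ rq)// leNgt; apply/negP => rs.
    by apply: Sr; exists s.
  by rewrite -Order.le_val zE leNgt qj.
- by move=> r [s Ss]; apply: mono (jub _ Ss) _.
Qed.

Theorem theorem3p2 :
  exists (d d' : Order.disp_t) (L : tbLatticeType d) (L' : tbLatticeType d'),
    [/\ elementarily_equivalent L L', CRL L' & ~ CRL L].
Proof.
exists ring_display, ring_display.
(* The reals serve twice: their interval is [L], and they supply the irrational cuts for [L']. *)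
exists (unit_interval Rdefinitions.R), (unit_interval rat); split.
- by apply: dense_chain_equivalent; exact: unit_interval_dense.
- exact: rational_unit_interval_CRL Rdefinitions.R.
- apply: complete_dense_chain_notin_CRL; first exact: unit_interval_dense.
  exact: real_unit_interval_infimum.
Qed.
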